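(* Let $\mathcal{B}$ be a swap structure for $\mathbf{mbCci}$. Then there exist a set $I$ and a monomorphism of multialgebras $\hat h:\mathcal{B}\to\prod_{i\in I}\mathcal{B}_{\mathbb{A}_2}^{\mathbf{mbCci}}$.
   Context: Let $\Sigma=\{\wedge,\vee,\to,\neg,\circ\}$, with $\wedge,\vee,\to$ binary and $\neg,\circ$ unary. A multialgebra over $\Sigma$ is a nonempty set $B$ with, for each $n$-ary symbol $c$, a function $c^{\mathcal{B}}:B^n\to\wp(B)\setminus\{\emptyset\}$. A homomorphism $f:\mathcal{A}\to\mathcal{B}$ is a function between the domains with $f[c^{\mathcal{A}}(\vec a)]\subseteq c^{\mathcal{B}}(f(\vec a))$ for all $c$ and $\vec a$. These form the category $\mathbf{MAlg}(\Sigma)$; a monomorphism of multialgebras is a monomorphism in this category. The product $\prod_{i\in I}\mathcal{A}_i$ has as domain the cartesian product of the domains and multioperations $c(\vec a)=\prod_{i\in I}c^{\mathcal{A}_i}(\pi_i(\vec a))$ (for $I=\emptyset$ it is the one-element multialgebra). For a Boolean algebra $\mathcal{A}$ with domain $A$ (the one-element Boolean algebra is allowed) and $z\in A^3$ write $z=(z_1,z_2,z_3)$; $\sim$ is Boolean complement. Put $\mathrm{B}_{\mathcal{A}}^{\mathbf{ciw}}=\{z\in A^3 : z_1\vee z_2=1 \text{ and } z_3={\sim}(z_1\wedge z_2)\}$. A swap structure for $\mathbf{mbCci}$ over $\mathcal{A}$ is a multialgebra $\mathcal{B}$ over $\Sigma$ with domain $B\subseteq \mathrm{B}_{\mathcal{A}}^{\mathbf{ciw}}$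 such that $0\in\{z_1: z\in B\}$ and for all $z,w\in B$: (i) $\emptyset\ne z\#w\subseteq\{u\in B: u_1=z_1\# w_1\}$ for $\#\in\{\wedge,\vee,\to\}$; (ii) $\emptyset\neq\neg z\subseteq\{u\in B:u_1=z_2\}$; (iii) $\circ z=\{({\sim}(z_1\wedge z_2),z_1\wedge z_2,1)\}$. A swap structure for $\mathbf{mbCci}$ is one over some Boolean algebra. The full swap structure $\mathcal{B}_{\mathcal{A}}^{\mathbf{mbCci}}$ has domain $\mathrm{B}_{\mathcal{A}}^{\mathbf{ciw}}$ and equality in the right-hand inclusions of (i)–(ii), with (iii) unchanged. $\mathbb{A}_2$ is the two-element Boolean algebra. *)

(* Defs.v *)
From HB Require Import structures.
From mathcomp Require Import all_boot all_order.
From mathcomp Require Import boolp classical_sets.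

Set Implicit Arguments.
Unset Strict Implicit.
Unset Printing Implicit Defensive.

Import Order.Theory.
Local Open Scope classical_set_scope.

Inductive symbol := And | Or | Imp | Neg | Circ.

Definition arity (c : symbol) : nat :=
  match c with And | Or | Imp => 2 | Neg | Circ => 1 end.

Record multiops (B : Type) := MultiOps {
  mop_ : forall c : symbol, (arity c).-tuple B -> set B;
  mop_neq0_ : forall c (t : (arity c).-tuple B), mop_ t !=set0;
  mop_inhabited_ : inhabited B }.

Record multialgebra := MultiAlgebra {
  domain :> Type;
  domain_ops : multiops domain }.

Definition mop (A : multialgebra) (c : symbol) :
    (arity c).-tuple A -> set A := @mop_ A (domain_ops A) c.

Lemma mop_neq0 (A : multialgebra) c (t : (arity c).-tuple A) : mop t !=set0.
Proof. exact: mop_neq0_. Qed.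

Definition is_hom (A B : multialgebra) (f : A -> B) : Prop :=
  forall (c : symbol) (t : (arity c).-tuple A),
    f @` mop t `<=` mop (map_tuple f t).

(* Monomorphisms are the left-cancellable arrows of MAlg(Sigma); injectivity
   is not part of the definition. *)
Definition is_mono (A B : multialgebra) (f : A -> B) : Prop :=
  is_hom f /\
  forall (C : multialgebra) (g h : C -> A),
    is_hom g -> is_hom h -> f \o g = f \o h -> g = h.

Section Product.
Variables (I : Type) (A : I -> multialgebra).

Definition prod_mop (c : symbol) (t : (arity c).-tuple (forall i, A i)) :
    set (forall i, A i) :=
  [set u | forall i, mop (map_tuple (fun x => x i) t) (u i)].

Lemma prod_mop_neq0 c (t : (arity c).-tuple (forall i, A i)) :
  prod_mop t !=set0.
Proof.
by exists (fun i => sval (cid (mop_neq0 (map_tuple (fun x => x i) t)))) => i;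
  case: cid.
Qed.

Lemma prod_inhabited : inhabited (forall i, A i).
Proof.
have inh i : exists x : A i, True.
  by case: (mop_inhabited_ (domain_ops (A i))) => x; exists x.
by constructor=> i; exact: (sval (cid (inh i))).
Qed.

Definition mprod : multialgebra :=
  MultiAlgebra (MultiOps prod_mop_neq0 prod_inhabited).

End Product.

Section Swap.
Context {d : Order.disp_t} {A : ctbDistrLatticeType d}.
Implicit Types a b : A.

Definition bimp a b : A := (~` a `|` b)%O.

Definition p1 (z : A * A * A) : A := z.1.1.
Definition p2 (z : A * A * A) : A := z.1.2.
Definition p3 (z : A * A * A) : A := z.2.

Definition Bciw : set (A * A * A) :=
  [set z | (p1 z `|` p2 z)%O = \top%O /\ p3 z = (~` (p1 z `&` p2 z))%O].

Definition circ_val (z : A * A * A) : A * A * A :=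
  ((~` (p1 z `&` p2 z))%O, (p1 z `&` p2 z)%O, \top%O).

(* A set used as a type is the corresponding subtype, with injection [\val].
   Non-emptiness of the multioperations is already part of [multiops]. *)
Record is_swap (B : set (A * A * A)) (M : multiops B) : Prop := IsSwap {
  swap_sub : B `<=` Bciw;
  swap_bot : [set p1 z | z in B] \bot%O;
  swap_and : forall z w : B,
    mop_ M (c := And) [tuple z; w] `<=`
      [set u | p1 (\val u) = (p1 (\val z) `&` p1 (\val w))%O];
  swap_or : forall z w : B,
    mop_ M (c := Or) [tuple z; w] `<=`
      [set u | p1 (\val u) = (p1 (\val z) `|` p1 (\val w))%O];
  swap_imp : forall z w : B,
    mop_ M (c := Imp) [tuple z; w] `<=`
      [set u | p1 (\val u) = bimp (p1 (\val z)) (p1 (\val w))];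
  swap_neg : forall z : B,
    mop_ M (c := Neg) [tuple z] `<=` [set u | p1 (\val u) = p2 (\val z)];
  swap_circ : forall z : B,
    \val @` mop_ M (c := Circ) [tuple z] = [set circ_val (\val z)] }.

End Swap.

Record swap_structure d (A : ctbDistrLatticeType d) := SwapStructure {
  swap_dom : set (A * A * A);
  swap_ops : multiops swap_dom;
  swap_axioms : is_swap swap_ops }.

Coercion malg_of_swap d (A : ctbDistrLatticeType d) (B : swap_structure A) :
  multialgebra := MultiAlgebra (swap_ops B).

Section Full.
Context {d : Order.disp_t} (A : ctbDistrLatticeType d).
Let T : Type := @Bciw d A.

Definition full_mop (c : symbol) : (arity c).-tuple T -> set T :=
  match c return (arity c).-tuple T -> set T with
  | And => fun t => [set u | p1 (\val u) =
      (p1 (\val (tnth t ord0)) `&` p1 (\val (tnth t ord_max)))%O]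
  | Or => fun t => [set u | p1 (\val u) =
      (p1 (\val (tnth t ord0)) `|` p1 (\val (tnth t ord_max)))%O]
  | Imp => fun t => [set u | p1 (\val u) =
      bimp (p1 (\val (tnth t ord0))) (p1 (\val (tnth t ord_max)))]
  | Neg => fun t => [set u | p1 (\val u) = p2 (\val (tnth t ord0))]
  | Circ => fun t => [set u | \val u = circ_val (\val (tnth t ord0))]
  end.

Lemma Bciw_lift (a : A) : @Bciw d A (a, ~` a, \top)%O.
Proof. by rewrite /Bciw /p1 /p2 /p3/= joinxC meetxC compl0. Qed.

Lemma Bciw_circ z : @Bciw d A (circ_val z).
Proof. by rewrite /Bciw /circ_val /p1 /p2 /p3/= joinCx meetCx compl0. Qed.

Lemma full_mop_neq0 c (t : (arity c).-tuple T) : full_mop t !=set0.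
Proof.
have lift a : exists u : T, p1 (\val u) = a.
  by exists (SigSub (mem_set (Bciw_lift a))).
case: c t => t; try exact: lift.
by exists (SigSub (mem_set (Bciw_circ (\val (tnth t ord0))))).
Qed.

Lemma full_inhabited : inhabited T.
Proof. by constructor; exact: SigSub (mem_set (Bciw_lift \bot%O)). Qed.

Definition full_ops : multiops T := MultiOps full_mop_neq0 full_inhabited.

Lemma full_is_swap : is_swap full_ops.
Proof.
split=> //.
- by exists (\bot, ~` \bot, \top)%O => //; exact: Bciw_lift.
1-3: by move=> z w u.
- by move=> z u.
- move=> z; apply/seteqP; split=> [x [u /= -> <-//]|x /= ->].
  by exists (SigSub (mem_set (Bciw_circ (\val z)))).
Qed.

Definition full_swap : swap_structure A := SwapStructure full_is_swap.

End Full.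

(* Main.v *)
(** A Boolean algebra has enough morphisms to [bool] to separate its points
(the ultrafilter theorem, from Zorn's lemma). Applying every such morphism to
each coordinate sends a swap structure over [A] into a power of the full
two-valued one; the map is injective, hence left-cancellable. *)

Require Import Defs.
From mathcomp Require Import all_boot all_order.
From mathcomp Require Import boolp classical_sets.

Set Implicit Arguments.
Unset Strict Implicit.
Unset Printing Implicit Defensive.

Import Order.Theory.

(** Meet and complement suffice: join follows by De Morgan, and the bounds because [\bot] is the
    meet of an element with its complement. *)
Record boolean_morphism d d' (A : ctbDistrLatticeType d)
    (A' : ctbDistrLatticeType d') (f : A -> A') : Prop := BooleanMorphism {
  bmorphI : {morph f : x y / (x `&` y)%O};
  bmorphC : {morph f : x / (~` x)%O} }.

Section BooleanMorphism.
Context d d' (A : ctbDistrLatticeType d) (A' : ctbDistrLatticeType d').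
Variables (f : A -> A') (fM : boolean_morphism f).
Local Open Scope order_scope.

Lemma bmorphU : {morph f : x y / x `|` y}.
Proof.
move=> x y; rewrite -[x `|` y]complK complU (bmorphC fM) (bmorphI fM).
by rewrite !(bmorphC fM) complI !complK.
Qed.

Lemma bmorph0 : f \bot = \bot.
Proof. by rewrite -(meetxC \bot) (bmorphI fM) (bmorphC fM) meetxC. Qed.

Lemma bmorph1 : f \top = \top.
Proof. by rewrite -compl0 (bmorphC fM) bmorph0 compl0. Qed.

Lemma bmorph_imp x y : f (bimp x y) = bimp (f x) (f y).
Proof. by rewrite /bimp bmorphU (bmorphC fM). Qed.

End BooleanMorphism.

Section Ultrafilter.
Context d (A : ctbDistrLatticeType d).
Local Open Scope classical_set_scope.
Local Open Scope order_scope.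
Implicit Types (a b c x y : A) (X : set A).

(* The empty set is allowed, so that the union of the empty chain needs no
   special case in Zorn's lemma. *)
Record filter_compatible a X : Prop := FilterCompatible {
  fcompat : forall x, X x -> x `&` a != \bot;
  fmeet : forall x y, X x -> X y -> X (x `&` y);
  fup : forall x y, X x -> x <= y -> X y }.

Lemma filter_compatible_bigcup a (F : set (set A)) :
  F `<=` filter_compatible a -> total_on F subset ->
  filter_compatible a (\bigcup_(X in F) X).
Proof.
move=> Fa Ftot; split.
- by move=> x [X FX Xx]; exact: (fcompat (Fa _ FX)).
- move=> x y [X FX Xx] [Y FY Yy]; have [XY|YX] := Ftot _ _ FX FY.
    by exists Y => //; apply: (fmeet (Fa _ FY)) => //; exact: XY.
  by exists X => //; apply: (fmeet (Fa _ FX)) => //; exact: YX.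
- by move=> x y [X FX Xx] xy; exists X => //; exact: (fup (Fa _ FX)) xy.
Qed.

(** If both [c] and its complement were missing, adjoining either one would break compatibility with
    [a]. The two witnesses of this meet in an element disjoint from [a], a contradiction. *)
Lemma maximal_filter_compl a X : a != \bot -> filter_compatible a X ->
    (forall Y, X `<` Y -> ~ filter_compatible a Y) ->
  forall c, X c \/ X (~` c).
Proof.
(* [X] may be empty; adding [\top] makes it a nonempty base closed under meets. *)
move=> a0 Xa Xmax c; pose X1 := \top |` X.
have X1I x y : X1 x -> X1 y -> X1 (x `&` y).
  move=> [->|Xx] [->|Xy]; rewrite ?meet1x ?meetx1; [by left|by right|by right|].
  by right; exact: (fmeet Xa).
have X1a x : X1 x -> x `&` a != \bot.
  by move=> [->|/(fcompat Xa)//]; rewrite meet1x.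
have inconsistent e : ~ X e -> exists2 x, X1 x & x `&` e `&` a = \bot.
  move=> nXe; apply: contrapT => con.
  (* The filter generated by [X1] and [e] is strictly larger than [X], since it contains [e]; [con]
     makes it compatible with [a]. *)
  apply: (Xmax [set y | exists2 x, X1 x & x `&` e <= y]).
    split=> [x Xx|XX]; first by exists x; [right|exact: leIl].
    by apply/nXe/XX; exists \top; [left|rewrite meet1x].
  split.
  - move=> y [x Xx xey]; apply/eqP => ya; apply: con; exists x => //.
    by apply/eqP; rewrite -lex0 -ya leI2.
  - move=> y y' [x Xx xey] [x' Xx' xey']; exists (x `&` x'); first exact: X1I.
    by rewrite lexI (le_trans _ xey) ?(le_trans _ xey') ?leI2 ?leIl ?leIr.
  - by move=> y y' [x Xx xey] yy'; exists x => //; exact: le_trans yy'.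
have [Xc|/inconsistent[x Xx xc]] := pselect (X c); first by left.
have [XNc|/inconsistent[y Xy yc]] := pselect (X (~` c)); first by right.
have /eqP[] := X1a _ (X1I _ _ Xx Xy).
(* Split the meet of [x], [y] and [a] along [c] and its complement: [xc] kills one half, [yc] the
   other. *)
apply/eqP; rewrite -lex0 -[leLHS]meetx1 -(joinxC c) meetUr leUx.
apply/andP; split; rewrite (meetAC _ a).
  by rewrite -{}xc !leI2 // leIl.
by rewrite -{}yc !leI2 // leIr.
Qed.

(** The morphism is the indicator of a maximal filter compatible with [a]. This filter contains [a],
    because the complement of [a] is disjoint from [a]. *)
Lemma exists_boolean_morphism a : a != \bot ->
  exists2 f : A -> bool, boolean_morphism f & f a.
Proof.
move=> a0; have [X [Xa Xmax]] := Zorn_bigcup (@filter_compatible_bigcup a).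
have Xcompl := maximal_filter_compl a0 Xa Xmax.
have XN c : X c -> ~ X (~` c).
  by move=> Xc /(fmeet Xa Xc)/(fcompat Xa); rewrite meetxC meet0x eqxx.
exists (fun x => `[< X x >]).
  split=> [x y|x].
    apply/asboolP/andP => [Xxy|[/asboolP Xx /asboolP Xy]]; last first.
      exact: (fmeet Xa).
    by split; apply/asboolP; apply: (fup Xa) Xxy _; rewrite ?leIl ?leIr.
  apply/asboolP/negP => [XNx /asboolP /XN//|nXx].
  by case: (Xcompl x) => // /asboolP.
apply/asboolP; case: (Xcompl a) => // /(fcompat Xa).
by rewrite meetCx eqxx.
Qed.

(** If [u] is not below [v], some morphism is true at the meet of [u] with the complement of [v],
    hence true at [u] and false at [v]. *)
Lemma boolean_morphism_separates x y :
  (forall f : A -> bool, boolean_morphism f -> f x = f y) -> x = y.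
Proof.
suff le_sep u v : (forall f : A -> bool, boolean_morphism f -> f u = f v) ->
    u <= v.
  by move=> fxy; apply/le_anti; rewrite !le_sep // => f /fxy.
move=> fuv; have [uv0|/exists_boolean_morphism[f fM]] :=
  eqVneq (u `&` ~` v) \bot.
  rewrite -[u]meetx1 -(joinxC v) meetUr uv0 joinx0; exact: leIr.
by rewrite (bmorphI fM) (bmorphC fM) (fuv f fM) meetxC.
Qed.

End Ultrafilter.

Lemma inj_hom_is_mono (A B : multialgebra) (f : A -> B) :
  is_hom f -> injective f -> is_mono f.
Proof.
move=> fhom finj; split=> // C g h _ _ fgh; apply/funext => x; apply: finj.
exact: (congr1 (fun k => k x) fgh).
Qed.

Section Representation.
Context d d' (A : ctbDistrLatticeType d) (A' : ctbDistrLatticeType d').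
Variables (B : swap_structure A) (f : A -> A') (fM : boolean_morphism f).
Local Open Scope classical_set_scope.

Definition map3 (z : A * A * A) : A' * A' * A' :=
  (f (p1 z), f (p2 z), f (p3 z)).

Lemma map3_Bciw z : Bciw z -> Bciw (map3 z).
Proof.
case=> z12 z3; rewrite /Bciw /map3 /p1 /p2 /p3 /= in z12 z3 *.
by rewrite -(bmorphU fM) z12 (bmorph1 fM) z3 (bmorphC fM) (bmorphI fM).
Qed.

Lemma map3_circ z : map3 (circ_val z) = circ_val (map3 z).
Proof.
rewrite /map3 /circ_val /p1 /p2 /p3 /=.
by rewrite (bmorphC fM) (bmorphI fM) (bmorph1 fM).
Qed.

Definition swap_map (z : B) : full_swap A' :=
  SigSub (mem_set (map3_Bciw (swap_sub (swap_axioms B) (set_valP z)))).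

(** Except for [Circ], the full structure constrains only the first coordinate of a result, so it
    suffices that [f] preserves the Boolean operation there. *)
Lemma swap_map_hom : is_hom swap_map.
Proof.
have ax := swap_axioms B.
move=> c t _ [u tu <-]; case: c t tu => t;
  case/tupleP: t => z t; try (case/tupleP: t => w t); rewrite tuple0 => tu.
- exact: etrans (congr1 f (swap_and ax tu)) (bmorphI fM _ _).
- exact: etrans (congr1 f (swap_or ax tu)) (bmorphU fM _ _).
- exact: etrans (congr1 f (swap_imp ax tu)) (bmorph_imp fM _ _).
- exact: etrans (congr1 f (swap_neg ax tu)) erefl.
(* [Circ] is single-valued in [B], which determines all three coordinates of [u]. *)
- have : [set circ_val (\val z)] (\val u) by rewrite -(swap_circ ax); exists u.
  by rewrite /mop /= => ->; rewrite map3_circ.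
Qed.

End Representation.

Theorem theorem8p21 (d : Order.disp_t) (A : ctbDistrLatticeType d)
    (B : swap_structure A) :
  exists (I : Type) (h : B -> mprod (fun _ : I => full_swap bool)),
    is_mono h.
Proof.
(* This index type is empty when [A] has one element; the product is then a single point, and so is
   [B]. *)
exists {f : A -> bool | boolean_morphism f}.
exists (fun z f => swap_map (svalP f) z); apply: inj_hom_is_mono.
- move=> c t _ [u tu <-] f /=.
  have -> : map_tuple (fun x => x f)
      (map_tuple (fun z f => swap_map (svalP f) z) t) =
      map_tuple (swap_map (svalP f)) t.
    by apply: eq_from_tnth => i; rewrite !tnth_map.
  by apply: swap_map_hom; exists u.
- move=> z w zw; apply: val_inj.
  have eq_f (f : A -> bool) (fM : boolean_morphism f) :
      map3 f (\val z) = map3 f (\val w).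
    exact: (congr1 (fun k => \val (k (exist _ f fM))) zw).
  case: (\val z) (\val w) eq_f => [[z1 z2] z3] [[w1 w2] w3] eq_f.
  by congr (_, _, _); apply: boolean_morphism_separates => f /eq_f[].
Qed.
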